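(* Let $A_1,B_1,A_2,B_2$ be smooth $\mathbb{R}_{0,m}$-valued functions depending only on $\underline{y}$. The function $$(\cos z)A_1(\underline{y})+(\sin z)B_1(\underline{y})+(\cos\overline{z})A_2(\underline{y})+(\sin\overline{z})B_2(\underline{y})$$ is two-sided monogenic if and only if $A_1$ and $B_1$ are harmonic and satisfy the system $$A_1\partial_{\underline{y}}+B_1+e_1B_1e_1=0,\qquad B_1\partial_{\underline{y}}-A_1-e_1A_1e_1=0,$$ and $A_2=\frac{1}{2}\partial_{\underline{y}}B_1$, $B_2=-\frac{1}{2}\partial_{\underline{y}}A_1$. In particular, if $M(\underline{y})$ and $N(\underline{y})$ are right monogenic functions of $\underline{y}$ (i.e. $M\partial_{\underline{y}}=N\partial_{\underline{y}}=0$), then $$(\cos z)(M-e_1Me_1)+(\sin z)(N-e_1Ne_1)+\frac{1}{2}(\cos\overline{z})(\partial_{\underline{y}}N+e_1(\partial_{\underline{y}}N)e_1)-\frac{1}{2}(\sin\overline{z})(\partial_{\underline{y}}M+e_1(\partial_{\underline{y}}M)e_1)$$ is two-sided monogenic.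
   Context: Let $m\ge 2$ and let $\mathbb{R}_{0,m}$ be the real Clifford algebra generated by $e_1,\dots,e_m$ with $e_i^2=-1$ and $e_ie_j=-e_je_i$ for $i\neq j$; all products are Clifford products. Identify $(x_0,\dots,x_m)\in\mathbb{R}^{m+1}$ with $X=x_0+\sum_{j=1}^m x_je_j$, and write $z=x_0+x_1e_1$, $\overline{z}=x_0-x_1e_1$, $\underline{y}=\sum_{j=2}^m x_je_j$. The subalgebra spanned by $1,e_1$ is identified with $\mathbb{C}$ via $i\mapsto e_1$, and $\cos z,\sin z,\cos\overline z,\sin\overline z$ are the complex cosine and sine under this identification. Operators: $\partial_X f=\partial_{x_0}f+\sum_{j=1}^m e_j\partial_{x_j}f$, $f\partial_X=\partial_{x_0}f+\sum_{j=1}^m(\partial_{x_j}f)e_j$, $\partial_{\underline{y}}f=\sum_{j=2}^m e_j\partial_{x_j}f$, $f\partial_{\underline{y}}=\sum_{j=2}^m(\partial_{x_j}f)e_j$. A function is left monogenic if $\partial_Xf=0$, right monogenic if $f\partial_X=0$, two-sided monogenic if both. Harmonic means $\Delta A=0$ with $\Delta=\sum_{j=2}^m\partial_{x_j}^2=-\partial_{\underline{y}}^2$. *)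

(* Defs.v *)
From HB Require Import structures.
From mathcomp Require Import all_boot all_order all_algebra.
From mathcomp Require Import all_classical all_reals all_analysis.
Set Implicit Arguments. Unset Strict Implicit. Unset Printing Implicit Defensive.
Import Order.TTheory GRing.Theory Num.Theory.
Import numFieldNormedType.Exports.
Local Open Scope ring_scope.

Section Clifford.
Variables (R : realType) (m : nat).

(* The real Clifford algebra R_{0,m}: an element is the family of its
   coordinates on the basis e_A = e_{a_1} ... e_{a_k} (a_1 < ... < a_k),
   A a subset of the generator indices.  Index i : 'I_m stands for the
   generator e_{i+1}. *)
Definition cl := {ffun {set 'I_m} -> R}.

(* sign in e_A e_B = clsign A B * e_{A delta B}  (using e_i^2 = -1,
   e_i e_j = - e_j e_i) *)
Definition clsign (A B : {set 'I_m}) : R :=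
  (-1) ^+ (#|A :&: B| +
           #|[set p : 'I_m * 'I_m | (p.1 \in A) && (p.2 \in B) && (p.2 < p.1)%N]|).

Definition clbasis (A : {set 'I_m}) : cl := [ffun C => (C == A)%:R].

Definition clmul (a b : cl) : cl :=
  [ffun C => \sum_(A : {set 'I_m}) \sum_(B : {set 'I_m} | (A :\: B) :|: (B :\: A) == C)
                clsign A B * a A * b B].

Definition clscal (r : R) : cl := r *: clbasis (finset.set0 : {set 'I_m}).

(* generator e_j, 1 <= j <= m (paper's indexing) *)
Definition gen (j : nat) : cl := clbasis [set i : 'I_m | (i : nat).+1 == j].

Definition cplx (u v : R) : cl := clscal u + v *: gen 1.

Definition pt := 'rV[R]_(m.+1).
Definition coord (X : pt) (j : nat) : R := X ord0 (inord j).

Definition rpd (j : 'I_(m.+1)) (g : pt -> R) : pt -> R :=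
  fun X => 'D_(delta_mx 0 j) g X.

Definition riterpd (l : seq 'I_(m.+1)) (g : pt -> R) : pt -> R :=
  foldr rpd g l.

Definition rsmooth (g : pt -> R) : Prop :=
  forall (l : seq 'I_(m.+1)) (X : pt), differentiable (riterpd l g) X.

Definition comp (f : pt -> cl) (A : {set 'I_m}) : pt -> R := fun X => f X A.

Definition smooth (f : pt -> cl) : Prop := forall A, rsmooth (comp f A).

Definition pd (j : 'I_(m.+1)) (f : pt -> cl) : pt -> cl :=
  fun X => [ffun A => rpd j (comp f A) X].

Definition depends_only_on_y (f : pt -> cl) : Prop :=
  forall X Y : pt, (forall j : 'I_(m.+1), (2 <= j)%N -> X ord0 j = Y ord0 j) ->
    f X = f Y.

Definition dX_left (f : pt -> cl) : pt -> cl :=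
  fun X => pd ord0 f X + \sum_(j < m.+1 | (1 <= j)%N) clmul (gen j) (pd j f X).
Definition dX_right (f : pt -> cl) : pt -> cl :=
  fun X => pd ord0 f X + \sum_(j < m.+1 | (1 <= j)%N) clmul (pd j f X) (gen j).
Definition dy_left (f : pt -> cl) : pt -> cl :=
  fun X => \sum_(j < m.+1 | (2 <= j)%N) clmul (gen j) (pd j f X).
Definition dy_right (f : pt -> cl) : pt -> cl :=
  fun X => \sum_(j < m.+1 | (2 <= j)%N) clmul (pd j f X) (gen j).

Definition left_monogenic (f : pt -> cl) : Prop := forall X, dX_left f X = 0.
Definition right_monogenic (f : pt -> cl) : Prop := forall X, dX_right f X = 0.
Definition two_sided_monogenic (f : pt -> cl) : Prop :=
  left_monogenic f /\ right_monogenic f.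

Definition lap_y (f : pt -> cl) : pt -> cl :=
  fun X => \sum_(j < m.+1 | (2 <= j)%N) pd j (pd j f) X.
Definition harmonic (f : pt -> cl) : Prop := forall X, lap_y f X = 0.

(* complex cosine and sine of z = x_0 + x_1 e_1 and of its conjugate,
   via cos(a+ib) = cos a cosh b - i sin a sinh b,
       sin(a+ib) = sin a cosh b + i cos a sinh b *)
Definition cosh (x : R) : R := (expR x + expR (- x)) / 2.
Definition sinh (x : R) : R := (expR x - expR (- x)) / 2.

Definition cos_z (X : pt) : cl :=
  cplx (cos (coord X 0) * cosh (coord X 1)) (- (sin (coord X 0) * sinh (coord X 1))).
Definition sin_z (X : pt) : cl :=
  cplx (sin (coord X 0) * cosh (coord X 1)) (cos (coord X 0) * sinh (coord X 1)).
Definition cos_zbar (X : pt) : cl :=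
  cplx (cos (coord X 0) * cosh (coord X 1)) (sin (coord X 0) * sinh (coord X 1)).
Definition sin_zbar (X : pt) : cl :=
  cplx (sin (coord X 0) * cosh (coord X 1)) (- (cos (coord X 0) * sinh (coord X 1))).

End Clifford.

(* Main.v *)
(* Write F for the function of the theorem and dy for the Dirac operator in the
   variables x_2, ..., x_m.  Since e_j z = zbar e_j for j >= 2, applying the
   Cauchy-Riemann operator to F on either side gives again a combination of
   cos z, sin z, cos zbar, sin zbar with coefficients depending only on y:
     on the left:   dy A2,  dy B2,  dy A1 + 2 B2,  dy B1 - 2 A2;
     on the right:  A1 dy + (B1 + e1 B1 e1),  B1 dy - (A1 + e1 A1 e1),
                    A2 dy + (B2 - e1 B2 e1),  B2 dy - (A2 - e1 A2 e1).
   These four functions are linearly independent, so F is two-sided monogenic iff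
   all eight coefficients vanish.  The left ones say that A2 = dy B1 / 2,
   B2 = - dy A1 / 2 and, because dy^2 = - Delta, that A1 and B1 are harmonic.  The
   last two right ones then follow from the first two, as dy commutes with the right
   Dirac operator and anticommutes with a |-> e1 a e1. *)
From Pilot Require Import Defs.
From HB Require Import structures.
From mathcomp Require Import all_boot all_order all_algebra.
From mathcomp Require Import all_classical all_reals all_analysis.
From mathcomp Require Import ring lra.
Import Order.TTheory GRing.Theory Num.Theory.
Import numFieldNormedType.Exports.
Import Pilot.Defs.
Local Open Scope ring_scope.

(** * The Clifford algebra: bilinearity, associativity and the relations between generators *)

Section CliffordAlgebra.
Set Implicit Arguments.
Unset Strict Implicit.
Variables (R : realType) (m : nat).
Implicit Types (a b c : cl R m) (A B C : {set 'I_m}).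
Local Notation "a ** b" := (clmul a b) (at level 40, left associativity).
Local Notation "1%cl" := (clbasis R (finset.set0 : {set 'I_m})).

Lemma cl_ext a b : (forall A, a A = b A) -> a = b.
Proof. by move=> ab; apply/ffunP. Qed.

Lemma clDE a b A : (a + b) A = a A + b A.
Proof. by rewrite ffunE. Qed.

Lemma clNE a A : (- a) A = - a A.
Proof. by rewrite ffunE. Qed.

Lemma clZE (r : R) a A : (r *: a) A = r * a A.
Proof. by rewrite ffunE. Qed.

Lemma cl0E A : (0 : cl R m) A = 0.
Proof. by rewrite ffunE. Qed.

Definition clE := (clDE, clNE, clZE, cl0E).

Lemma cl_sumE (I : Type) (r : seq I) (P : pred I) (F : I -> cl R m) A :
  (\sum_(i <- r | P i) F i) A = \sum_(i <- r | P i) F i A.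
Proof.
by elim/big_rec2: _ => [|i y1 y2 _ <-]; rewrite ?clE.
Qed.

(** Under this operation the index sets form an elementary abelian 2-group, and the algebra is its
    group algebra twisted by the sign [clsign]. *)
Definition symdiff A B : {set 'I_m} := (A :\: B) :|: (B :\: A).

Lemma in_symdiff A B x : (x \in symdiff A B) = (x \in A) (+) (x \in B).
Proof. by rewrite !inE; case: (x \in A); case: (x \in B). Qed.

Lemma symdiffA A B C : symdiff A (symdiff B C) = symdiff (symdiff A B) C.
Proof. by apply/setP=> x; rewrite !in_symdiff addbA. Qed.

Lemma symdiff0 A : symdiff A finset.set0 = A.
Proof. by apply/setP=> x; rewrite in_symdiff inE addbF. Qed.

Lemma sym0diff A : symdiff finset.set0 A = A.
Proof. by apply/setP=> x; rewrite in_symdiff inE. Qed.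

(* Reordering moves the generators of [A] past the smaller ones of [B], and each
   common generator squares to -1: together, one sign per pair [b <= a]. *)
Lemma clsignE A B : clsign R A B =
  \prod_(i : 'I_m) \prod_(j : 'I_m)
    (-1) ^+ [&& i \in A, j \in B & (j <= i)%N].
Proof.
rewrite (pair_bigA _ (fun i j : 'I_m => _)) /= GRing.prodrXr; congr (_ ^+ _).
have cardA (T : finType) (P : pred T) : #|[set x | P x]| = (\sum_x P x)%N.
  by rewrite -sum1_card big_mkcond; apply: eq_bigr => x _; rewrite inE; case: P.
have -> : #|A :&: B| = (\sum_(p : 'I_m * 'I_m) [&& p.1 \in A, p.2 \in B & p.2 == p.1])%N.
  rewrite -(pair_bigA _ (fun i j : 'I_m => nat_of_bool [&& i \in A, j \in B & j == i])) /=.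
  have -> : A :&: B = [set x | (x \in A) && (x \in B)] by apply/setP=> x; rewrite !inE.
  rewrite cardA; apply: eq_bigr => i _; rewrite (bigD1 i) //= eqxx andbT.
  by rewrite big1 ?addn0 // => j /negPf ->; rewrite !andbF.
rewrite cardA -big_split /=; apply: eq_bigr => -[i j] _ /=.
rewrite (leq_eqVlt j i) -val_eqE.
by case: (i \in A) => //=; case: (j \in B) => //=; case: (ltngtP j i).
Qed.

(** Membership in a symmetric difference is a sum modulo 2, and a power of -1 depends only on its
    exponent modulo 2. The sign is therefore multiplicative in each argument, which is what
    associativity rests on. *)
Lemma clsign_symdiffl A B C :
  clsign R (symdiff A B) C = clsign R A C * clsign R B C.
Proof.
rewrite !clsignE -big_split; apply: eq_bigr => i _ /=.
rewrite -big_split; apply: eq_bigr => j _ /=.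
by rewrite in_symdiff andb_addl signr_addb.
Qed.

Lemma clsign_symdiffr A B C :
  clsign R A (symdiff B C) = clsign R A B * clsign R A C.
Proof.
rewrite !clsignE -big_split; apply: eq_bigr => i _ /=.
rewrite -big_split; apply: eq_bigr => j _ /=.
by rewrite in_symdiff andb_addl andb_addr signr_addb.
Qed.

Lemma clsign0s A : clsign R finset.set0 A = 1.
Proof.
by rewrite clsignE; apply: big1 => i _; apply: big1 => j _; rewrite inE.
Qed.

Lemma clsigns0 A : clsign R A finset.set0 = 1.
Proof.
by rewrite clsignE; apply: big1 => i _; apply: big1 => j _; rewrite inE andbF.
Qed.

Lemma clmulDl a b c : (a + b) ** c = a ** c + b ** c.
Proof.
apply/ffunP=> C; rewrite clDE /clmul !ffunE -big_split; apply: eq_bigr => A _ /=.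
by rewrite -big_split; apply: eq_bigr => B _ /=; rewrite clDE mulrDr mulrDl.
Qed.

Lemma clmulDr a b c : a ** (b + c) = a ** b + a ** c.
Proof.
apply/ffunP=> C; rewrite clDE /clmul !ffunE -big_split; apply: eq_bigr => A _ /=.
by rewrite -big_split; apply: eq_bigr => B _ /=; rewrite clDE mulrDr.
Qed.

Lemma clmulZl (r : R) a b : (r *: a) ** b = r *: (a ** b).
Proof.
apply/ffunP=> C; rewrite clZE /clmul !ffunE mulr_sumr; apply: eq_bigr => A _ /=.
by rewrite mulr_sumr; apply: eq_bigr => B _ /=; rewrite clZE; ring.
Qed.

Lemma clmulZr (r : R) a b : a ** (r *: b) = r *: (a ** b).
Proof.
apply/ffunP=> C; rewrite clZE /clmul !ffunE mulr_sumr; apply: eq_bigr => A _ /=.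
by rewrite mulr_sumr; apply: eq_bigr => B _ /=; rewrite clZE; ring.
Qed.

Lemma clmul_linear a : linear (clmul a).
Proof. by move=> r b c; rewrite clmulDr clmulZr. Qed.

Lemma clmulr_linear b : linear (fun a => a ** b).
Proof. by move=> r a c; rewrite clmulDl clmulZl. Qed.

HB.instance Definition _ a :=
  GRing.isLinear.Build R (cl R m) (cl R m) _ (clmul a) (clmul_linear a).

(** A named form of right multiplication, to which a linear structure can be attached; the generic
    facts on linear maps then serve on both sides. *)
Definition clmulr b a := a ** b.
HB.instance Definition _ b :=
  GRing.isLinear.Build R (cl R m) (cl R m) _ (clmulr b) (clmulr_linear b).

Lemma clmulNl a b : (- a) ** b = - (a ** b).
Proof. exact: (linearN (clmulr b)). Qed.

Lemma clmulNr a b : a ** (- b) = - (a ** b).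
Proof. exact: linearN. Qed.

Lemma clmul_suml (I : Type) (r : seq I) (P : pred I) (F : I -> cl R m) b :
  (\sum_(i <- r | P i) F i) ** b = \sum_(i <- r | P i) F i ** b.
Proof. exact: (linear_sum (clmulr b)). Qed.

Lemma clmul_sumr (I : Type) (r : seq I) (P : pred I) (F : I -> cl R m) a :
  a ** (\sum_(i <- r | P i) F i) = \sum_(i <- r | P i) a ** F i.
Proof. exact: linear_sum. Qed.

Lemma cl_basisE a : a = \sum_A a A *: clbasis R A.
Proof.
apply/ffunP=> C; rewrite cl_sumE (bigD1 C) //= clZE ffunE eqxx mulr1.
by rewrite big1 ?addr0 // => A /negPf nAC; rewrite clZE ffunE eq_sym nAC mulr0.
Qed.

Lemma clmul_basis A B :
  clbasis R A ** clbasis R B = clsign R A B *: clbasis R (symdiff A B).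
Proof.
apply/ffunP=> C; rewrite clZE /clmul !ffunE (bigD1 A) //= [X in _ + X]big1 ?addr0.
  rewrite big_mkcond (bigD1 B) //= !ffunE !eqxx [X in _ + X]big1 ?addr0.
    by rewrite eq_sym /symdiff; case: eqP; rewrite !(mulr1, mulr0).
  by move=> D /negPf nDB; rewrite !ffunE nDB mulr0; case: ifP.
by move=> D /negPf nDA; apply: big1 => E _; rewrite !ffunE nDA mulr0 mul0r.
Qed.

(** Reduces an identity that is linear in one variable to basis elements; [clmulA] uses it once per
    factor. *)
Lemma cl_linear_ext (f g : {linear cl R m -> cl R m}) :
  (forall A, f (clbasis R A) = g (clbasis R A)) -> f =1 g.
Proof.
move=> fg a; rewrite (cl_basisE a) !linear_sum; apply: eq_bigr => A _.
by rewrite !linearZ fg.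
Qed.

(** On basis elements both bracketings give the same index set, and by multiplicativity both signs
    are the product of the signs of the pairs [A B], [A C] and [B C]. *)
Lemma clmulA a b c : a ** (b ** c) = a ** b ** c.
Proof.
pose f1 := [the {linear cl R m -> cl R m} of clmulr (b ** c)].
pose g1 := [the {linear cl R m -> cl R m} of clmulr c \o clmulr b].
apply: (cl_linear_ext (f := f1) (g := g1)) => A; rewrite /= /clmulr.
pose f2 := [the {linear cl R m -> cl R m} of clmul (clbasis R A) \o clmulr c].
pose g2 := [the {linear cl R m -> cl R m} of clmulr c \o clmul (clbasis R A)].
apply: (cl_linear_ext (f := f2) (g := g2)) => B; rewrite /= /clmulr.
pose f3 := [the {linear cl R m -> cl R m} of clmul (clbasis R A) \o clmul (clbasis R B)].
pose g3 := [the {linear cl R m -> cl R m} of clmul (clbasis R A ** clbasis R B)].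
apply: (cl_linear_ext (f := f3) (g := g3)) => C; rewrite /=.
rewrite !clmul_basis clmulZl clmulZr !clmul_basis !scalerA symdiffA.
by congr (_ *: _); rewrite clsign_symdiffl clsign_symdiffr; ring.
Qed.

Lemma clmul1l a : 1%cl ** a = a.
Proof.
apply: (cl_linear_ext (f := clmul 1%cl) (g := idfun)) => A /=.
by rewrite clmul_basis clsign0s scale1r sym0diff.
Qed.

Lemma clmul1r a : a ** 1%cl = a.
Proof.
apply: (cl_linear_ext (f := clmulr 1%cl) (g := idfun)) => A /=.
by rewrite /clmulr clmul_basis clsigns0 scale1r symdiff0.
Qed.

Lemma genE (i : 'I_m) : gen R m i.+1 = clbasis R [set i].
Proof.
by rewrite /gen; congr clbasis; apply/setP=> j; rewrite !inE eqSS.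
Qed.

Lemma clsign_set1 (i j : 'I_m) : clsign R [set i] [set j] = (-1) ^+ (j <= i)%N.
Proof.
rewrite clsignE (bigD1 i) //= (bigD1 j) //= !inE !eqxx /= big1 ?mulr1.
  rewrite big1 ?mulr1 // => k /negPf nki; apply: big1 => l _.
  by rewrite !inE nki.
by move=> k /negPf nkj; rewrite !inE nkj.
Qed.

(** The range matters: outside it [gen] is indexed by the empty set and is the unit, whose square is
    not -1. *)
Lemma gen_sqr (i : nat) : (0 < i <= m)%N -> gen R m i ** gen R m i = - 1%cl.
Proof.
case: i => // i /= im; rewrite (genE (Ordinal im)) clmul_basis clsign_set1 leqnn.
rewrite expr1 scaleN1r; congr (- clbasis R _).
by apply/setP=> x; rewrite in_symdiff addbb inE.
Qed.

Lemma gen_anticomm (i j : nat) : (0 < i <= m)%N -> (0 < j <= m)%N -> i != j ->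
  gen R m i ** gen R m j = - (gen R m j ** gen R m i).
Proof.
case: i j => // i [] // j /= im jm nij.
rewrite (genE (Ordinal im)) (genE (Ordinal jm)) !clmul_basis !clsign_set1 /=.
have -> : symdiff [set Ordinal jm] [set Ordinal im] =
          symdiff [set Ordinal im] [set Ordinal jm].
  by apply/setP=> x; rewrite !in_symdiff addbC.
(* As the indices differ, exactly one of [j <= i] and [i <= j] holds, so exactly one of the two
   orders carries a minus sign. *)
by move: nij; rewrite eqSS; case: ltngtP => //= _ _;
  rewrite ?expr0 ?expr1 ?scaleN1r ?scale1r ?opprK.
Qed.

End CliffordAlgebra.

(** * Symmetry of mixed directional derivatives *)

Section Schwarz.
Set Implicit Arguments.
Unset Strict Implicit.
Local Open Scope classical_set_scope.
Variables (R : realType) (n : nat).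
Implicit Types (g : 'rV[R]_n -> R) (X v w : 'rV[R]_n).

(** The one-variable quotient along a line is the directional quotient itself, so derivability and
    the value of the derivative transfer together. *)
Lemma derive_lineE g X v (t : R) :
  (fun h : R => h^-1 *: (((fun s : R => g (s *: v + X)) \o shift t) (h *: (1 : R^o)) - g (t *: v + X)))
  = (fun h : R => h^-1 *: ((g \o shift (t *: v + X)) (h *: v) - g (t *: v + X))).
Proof.
by apply/funext=> h /=; rewrite /= [h%:A]mulr1 scalerDl addrA.
Qed.

Lemma is_derive_line g X v (t : R) : derivable g (t *: v + X) v ->
  is_derive t 1 (fun s : R => g (s *: v + X)) ('D_v g (t *: v + X)).
Proof.
by move=> dg; apply: DeriveDef; rewrite /derivable /derive derive_lineE.
Qed.

Lemma MVT_line g X v (t : R) : 0 < t -> (forall Y, derivable g Y v) ->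
  exists2 s, 0 < s < t & g (t *: v + X) - g X = t * 'D_v g (s *: v + X).
Proof.
move=> t0 dg.
have dh s : is_derive s (1 : R) (fun s : R => g (s *: v + X)) ('D_v g (s *: v + X)).
  exact: is_derive_line.
have ch : {within `[0, t]%classic, continuous (fun s : R => g (s *: v + X))}.
  by apply: derivable_within_continuous => s _; apply: ex_derive.
have [s st E] := MVT t0 (fun s _ => dh s) ch.
exists s; first by move: st; rewrite in_itv.
by move: E; rewrite scale0r add0r subr0 mulrC.
Qed.

(** The second difference over a parallelogram is the increment in direction [v] of
    [k Y = g (t *: w + Y) - g Y]. The mean value theorem for [k] along [v], then for ['D_v g] along
    [w], turns it into a mixed derivative at an intermediate point. *)
Lemma MVT_square g X v w (t : R) : 0 < t -> (forall Y, derivable g Y v) ->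
  (forall Y, derivable ('D_v g) Y w) ->
  exists r s, [/\ 0 < r < t, 0 < s < t &
    g (t *: v + (t *: w + X)) - g (t *: w + X) - g (t *: v + X) + g X
    = t * (t * 'D_w ('D_v g) (s *: w + (r *: v + X)))].
Proof.
move=> t0 dg dvg.
pose k Y := g (t *: w + Y) - g Y.
have dsh Y : is_derive Y v (fun Y => g (t *: w + Y)) ('D_v g (t *: w + Y)).
  suff E : (fun h : R => h^-1 *: (((fun Y => g (t *: w + Y)) \o shift Y) (h *: v) - g (t *: w + Y)))
    = (fun h : R => h^-1 *: ((g \o shift (t *: w + Y)) (h *: v) - g (t *: w + Y))).
    by apply: DeriveDef; rewrite /derivable /derive E; [exact: dg|].
  by apply/funext=> h /=; rewrite addrCA.
have dk Y : is_derive Y v k ('D_v g (t *: w + Y) - 'D_v g Y).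
  by apply: is_deriveB; exact/derivableP.
have [r r0t E] := @MVT_line k X v t t0 (fun Y => ex_derive (is_derive := dk Y)).
have [s s0t E'] := @MVT_line ('D_v g) (r *: v + X) w t t0 dvg.
exists r, s; split=> //.
rewrite -E' -(derive_val (is_derive := dk _)) -E /k.
by rewrite (addrCA (t *: w)); ring.
Qed.

(** The second difference is symmetric in [v] and [w]. By [MVT_square] in both orders, the two mixed
    derivatives take a common value at two points of a small parallelogram at [X], and continuity at
    [X] brings the values there within any [e > 0] of each other. *)
Lemma derive_comm g X v w :
  (forall Y, derivable g Y v) -> (forall Y, derivable g Y w) ->
  (forall Y, derivable ('D_v g) Y w) -> (forall Y, derivable ('D_w g) Y v) ->
  {for X, continuous ('D_w ('D_v g))} -> {for X, continuous ('D_v ('D_w g))} ->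
  'D_w ('D_v g) X = 'D_v ('D_w g) X.
Proof.
move=> dv dw dvw dwv cvw cwv; apply/eqP; rewrite -subr_eq0 -normr_le0.
apply/ler_addgt0Pl => e e0; rewrite addr0.
have e2 : 0 < e / 2 by rewrite divr_gt0.
have := (nbhs_normP _ _).1 ((cvgrPdist_lt _ _).1 cvw _ e2).
move=> [d1 /= d10 H1].
have := (nbhs_normP _ _).1 ((cvgrPdist_lt _ _).1 cwv _ e2).
move=> [d2 /= d20 H2].
have [d d0 H] : exists2 d : R, 0 < d & forall Y, `|X - Y| < d ->
    `|'D_w ('D_v g) X - 'D_w ('D_v g) Y| < e / 2 /\
    `|'D_v ('D_w g) X - 'D_v ('D_w g) Y| < e / 2.
  exists (Num.min d1 d2); first by rewrite lt_min d10.
  by move=> Y; rewrite lt_min => /andP[h1 h2]; split; [apply: (H1 Y)|apply: (H2 Y)].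
have [t t0 near_X] : exists2 t : R, 0 < t & forall r s : R,
    0 < r < t -> 0 < s < t -> `|X - (s *: w + (r *: v + X))| < d.
  (* The added 1 keeps [M] positive when both directions vanish and makes the last estimate
     strict. *)
  pose M := `|v| + `|w| + 1.
  have M0 : 0 < M by rewrite ltr_wpDl ?addr_ge0.
  exists (d / M); first by rewrite divr_gt0.
  move=> r s /andP[r0 rt] /andP[s0 st].
  rewrite distrC addrA addrK (le_lt_trans (ler_normD _ _)) // !normrZ !gtr0_norm //.
  apply: (@le_lt_trans _ _ (d / M * (`|v| + `|w|))).
    by rewrite mulrDr addrC lerD // ler_wpM2r // ltW.
  by rewrite -[ltRHS](divfK (lt0r_neq0 M0)) ltr_pM2l ?divr_gt0 // ltrDl.
have [r [s [rt st E]]] := MVT_square X t0 dv dvw.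
have [r' [s' [rt' st' E']]] := MVT_square X t0 dw dwv.
have [a1 _] := H _ (near_X _ _ rt st).
have [_ b2] := H _ (near_X _ _ st' rt').
rewrite (addrCA (r' *: w)) in b2.
(* Exchanging [v] and [w] only permutes the terms of the second difference, so both intermediate
   values equal it divided by the square of [t]. *)
have ab (a b : R) :
    g (t *: v + (t *: w + X)) - g (t *: w + X) - g (t *: v + X) + g X = t * (t * a) ->
    g (t *: w + (t *: v + X)) - g (t *: v + X) - g (t *: w + X) + g X = t * (t * b) ->
    a = b.
  rewrite (addrCA (t *: w)) [X in X + _]addrAC => -> /(mulfI (lt0r_neq0 t0)).
  exact: (mulfI (lt0r_neq0 t0)).
rewrite (ab _ _ E E') in a1.
rewrite [leRHS]splitr; apply: le_trans (ler_distD _ _ _) (lerD (ltW a1) _).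
by rewrite distrC; exact: ltW b2.
Qed.

End Schwarz.

(** * Coordinatewise differentiation of Clifford-valued functions *)

Section Calculus.
Set Implicit Arguments.
Unset Strict Implicit.
Variables (R : realType) (m : nat).
Implicit Types (f g : pt R m -> cl R m) (u v : pt R m -> R) (X Y : pt R m).
Implicit Types (j k : 'I_m.+1).
Local Notation "a ** b" := (clmul a b) (at level 40, left associativity).

Lemma rpd_lin j (a : R) u v X : differentiable u X -> differentiable v X ->
  rpd j (fun X => a * u X + v X) X = a * rpd j u X + rpd j v X.
Proof.
move=> /diff_derivable du /diff_derivable dv.
rewrite /rpd (_ : (fun X => _) = (a *: u) + v) // deriveD // ?deriveZ //.
exact: derivableZ.
Qed.

Lemma differentiable_lin (a : R) u v X : differentiable u X -> differentiable v X ->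
  differentiable (fun X => a * u X + v X) X.
Proof.
by move=> du dv; apply: (differentiableD (f := a *: u)) => //; exact: differentiableZ.
Qed.

Lemma riterpd_lin l (a : R) u v : rsmooth u -> rsmooth v ->
  riterpd l (fun X => a * u X + v X) = (fun X => a * riterpd l u X + riterpd l v X).
Proof.
move=> su sv; elim: l => //= j l ->; apply/funext => X.
by rewrite rpd_lin.
Qed.

Lemma rsmooth_lin (a : R) u v : rsmooth u -> rsmooth v ->
  rsmooth (fun X => a * u X + v X).
Proof.
by move=> su sv l X; rewrite riterpd_lin //; exact: differentiable_lin.
Qed.

(** [riterpd] applies the last index of its list first, so differentiating the argument appends an
    index at the end. *)
Lemma rsmooth_rpd j u : rsmooth u -> rsmooth (rpd j u).
Proof.
by move=> su l X; have := su (rcons l j) X; rewrite /riterpd foldr_rcons.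
Qed.

Lemma rsmooth_diff u X : rsmooth u -> differentiable u X.
Proof. by move=> su; exact: (su [::]). Qed.

Lemma rsmooth0 : rsmooth (fun _ : pt R m => 0 : R).
Proof.
have E l : riterpd l (fun _ : pt R m => 0 : R) = (fun _ : pt R m => 0).
  by elim: l => //= j l ->; apply/funext=> X; rewrite /rpd derive_cst.
by move=> l X; rewrite E; exact: differentiable_cst.
Qed.

Section LinearCombination.
Variables (I : Type) (r : seq I) (c : I -> R) (w : I -> pt R m -> R).

Lemma rsmooth_sum : (forall i, rsmooth (w i)) ->
  rsmooth (fun X => \sum_(i <- r) c i * w i X).
Proof.
move=> sw; elim: r => [|i s IH].
  by rewrite (_ : (fun=> _) = (fun=> 0)); [exact: rsmooth0|apply/funext=> X; rewrite big_nil].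
rewrite (_ : (fun=> _) = (fun X => c i * w i X + \sum_(i <- s) c i * w i X)).
  exact: rsmooth_lin.
by apply/funext=> X; rewrite big_cons.
Qed.

Lemma differentiable_lin_sum X : (forall i, differentiable (w i) X) ->
  differentiable (fun X => \sum_(i <- r) c i * w i X) X.
Proof.
move=> dw; elim: r => [|i s IH].
  rewrite (_ : (fun=> _) = cst 0); first exact: differentiable_cst.
  by apply/funext=> Y; rewrite big_nil.
rewrite (_ : (fun=> _) = (fun X => c i * w i X + \sum_(i <- s) c i * w i X)).
  exact: differentiable_lin.
by apply/funext=> Y; rewrite big_cons.
Qed.

End LinearCombination.

Lemma rpd_sum (I : Type) (r : seq I) (c : I -> R) (w : I -> pt R m -> R) j X :
  (forall i, differentiable (w i) X) ->
  rpd j (fun X => \sum_(i <- r) c i * w i X) X = \sum_(i <- r) c i * rpd j (w i) X.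
Proof.
move=> dw; elim: r => [|i s IH].
  rewrite (_ : (fun=> _) = cst 0); first by rewrite big_nil /rpd derive_cst.
  by apply/funext=> Y; rewrite big_nil.
rewrite (_ : (fun=> _) = (fun X => c i * w i X + \sum_(i <- s) c i * w i X)).
  by rewrite rpd_lin ?big_cons ?IH //; exact: differentiable_lin_sum.
by apply/funext=> Y; rewrite big_cons.
Qed.

(** First-order regularity, weaker than [smooth]: enough for a single application of a first-order
    operator, and easy to check for products with the trigonometric factors. *)
Definition cldiff f := forall A X, differentiable (comp f A) X.

Lemma pdE j f X A : pd j f X A = rpd j (comp f A) X.
Proof. by rewrite /pd ffunE. Qed.

Lemma comp_pd j f A : comp (pd j f) A = rpd j (comp f A).
Proof. by apply/funext=> X; rewrite /comp pdE. Qed.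

Lemma smooth_diff f : smooth f -> cldiff f.
Proof. by move=> sf A X; exact: rsmooth_diff. Qed.

Lemma smooth_pd j f : smooth f -> smooth (pd j f).
Proof. by move=> sf A; rewrite comp_pd; exact: rsmooth_rpd. Qed.

(** The factor 1 gives the sum the shape expected by [rpd_lin], [rsmooth_lin] and
    [differentiable_lin]. *)
Lemma comp_addE f g A :
  comp (fun X => f X + g X) A = (fun X => 1 * comp f A X + comp g A X).
Proof. by apply/funext=> X; rewrite /comp clDE mul1r. Qed.

Lemma smoothD f g : smooth f -> smooth g -> smooth (fun X => f X + g X).
Proof. by move=> sf sg A; rewrite comp_addE; exact: rsmooth_lin. Qed.

Lemma cldiffD f g : cldiff f -> cldiff g -> cldiff (fun X => f X + g X).
Proof. by move=> df dg A X; rewrite comp_addE; exact: differentiable_lin. Qed.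

Lemma pdD j f g X : cldiff f -> cldiff g ->
  pd j (fun X => f X + g X) X = pd j f X + pd j g X.
Proof.
move=> df dg; apply: cl_ext => A.
by rewrite clDE !pdE comp_addE rpd_lin // mul1r.
Qed.

Section Linear.
Variable L : {linear cl R m -> cl R m}.

(** With the constant coefficients made explicit, smoothness and partial derivatives pass through
    every linear map, in particular through multiplication on either side. *)
Lemma comp_linearE f A : comp (fun X => L (f X)) A =
  (fun X => \sum_(B : {set 'I_m}) L (clbasis R B) A * comp f B X).
Proof.
apply/funext=> X; rewrite /comp [in LHS](cl_basisE (f X)) linear_sum cl_sumE.
by apply: eq_bigr => B _; rewrite linearZ clZE mulrC.
Qed.

Lemma smooth_linear f : smooth f -> smooth (fun X => L (f X)).
Proof. by move=> sf A; rewrite comp_linearE; exact: rsmooth_sum. Qed.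

Lemma cldiff_linear f : cldiff f -> cldiff (fun X => L (f X)).
Proof. by move=> df A X; rewrite comp_linearE; exact: differentiable_lin_sum. Qed.

Lemma pd_linear j f X : cldiff f -> pd j (fun X => L (f X)) X = L (pd j f X).
Proof.
move=> df; apply: cl_ext => A; rewrite pdE comp_linearE rpd_sum //.
rewrite [in RHS](cl_basisE (pd j f X)) linear_sum cl_sumE.
by apply: eq_bigr => B _; rewrite linearZ clZE pdE mulrC.
Qed.

End Linear.

Lemma smooth_sum (I : Type) (r : seq I) (P : pred I) (F : I -> pt R m -> cl R m) :
  (forall i, smooth (F i)) -> smooth (fun X => \sum_(i <- r | P i) F i X).
Proof.
move=> sF; elim: r => [|i s IH].
  rewrite (_ : (fun=> _) = (fun=> 0)); last by apply/funext=> X; rewrite big_nil.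
  move=> A; rewrite (_ : comp _ A = (fun=> 0)); first exact: rsmooth0.
  by apply/funext=> X; rewrite /comp cl0E.
case Pi : (P i).
  rewrite (_ : (fun=> _) = (fun X => F i X + \sum_(i <- s | P i) F i X)).
    exact: smoothD.
  by apply/funext=> X; rewrite big_cons Pi.
rewrite (_ : (fun=> _) = (fun X => \sum_(i <- s | P i) F i X)) //.
by apply/funext=> X; rewrite big_cons Pi.
Qed.

Lemma pd_sum j (I : Type) (r : seq I) (P : pred I) (F : I -> pt R m -> cl R m) X :
  (forall i, smooth (F i)) ->
  pd j (fun X => \sum_(i <- r | P i) F i X) X = \sum_(i <- r | P i) pd j (F i) X.
Proof.
move=> sF; elim: r => [|i s IH].
  rewrite big_nil; apply: cl_ext => A; rewrite pdE cl0E.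
  rewrite (_ : comp _ A = cst 0) /rpd ?derive_cst //.
  by apply/funext=> Y; rewrite /comp big_nil cl0E.
rewrite big_cons; case Pi : (P i).
  rewrite -IH -pdD; last 2 first.
  - exact: smooth_diff.
  - by apply: smooth_diff; exact: smooth_sum.
  by congr pd; apply/funext=> Y; rewrite big_cons Pi.
by rewrite -IH; congr pd; apply/funext=> Y; rewrite big_cons Pi.
Qed.

Lemma cldiff_scale u f : (forall X, differentiable u X) -> cldiff f ->
  cldiff (fun X => u X *: f X).
Proof.
move=> du df A X; rewrite (_ : comp _ A = u * comp f A).
  exact: differentiableM.
by apply/funext=> Y; rewrite /comp clZE.
Qed.

Lemma pd_scale j u f X : (forall X, differentiable u X) -> cldiff f ->
  pd j (fun X => u X *: f X) X = rpd j u X *: f X + u X *: pd j f X.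
Proof.
move=> du df; apply: cl_ext => A; rewrite clDE !clZE !pdE.
rewrite (_ : comp _ A = u * comp f A); last by apply/funext=> Y; rewrite /comp clZE.
rewrite /rpd deriveM; [|exact: diff_derivable..].
by rewrite addrC; congr (_ + _); rewrite mulrC.
Qed.

Lemma pd_comm (i j : 'I_m.+1) f X : smooth f -> pd i (pd j f) X = pd j (pd i f) X.
Proof.
move=> sf; apply: cl_ext => A; rewrite [LHS]pdE [RHS]pdE comp_pd comp_pd.
have sA := sf A.
apply: derive_comm => [Y|Y|Y|Y||].
- exact/diff_derivable/rsmooth_diff.
- exact/diff_derivable/rsmooth_diff.
- exact/diff_derivable/(rsmooth_diff _ (rsmooth_rpd j sA)).
- exact/diff_derivable/(rsmooth_diff _ (rsmooth_rpd i sA)).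
- exact/differentiable_continuous/(rsmooth_diff _ (rsmooth_rpd i (rsmooth_rpd j sA))).
- exact/differentiable_continuous/(rsmooth_diff _ (rsmooth_rpd j (rsmooth_rpd i sA))).
Qed.

(** Moving two points by the same vector preserves the equality of their coordinates of index at
    least 2, so the difference quotients coincide. *)
Lemma pd_depends_only_on_y j f : depends_only_on_y f -> depends_only_on_y (pd j f).
Proof.
move=> yf X Y XY; apply: cl_ext => A; rewrite !pdE /rpd /derive.
congr (lim (_ @ 0^'))%classic; apply/funext=> h; rewrite /comp /= (yf X Y) //.
by rewrite (yf (h *: delta_mx 0 j + X) (h *: delta_mx 0 j + Y)) // => k k2; rewrite !mxE XY.
Qed.

(** The coordinates of index at least 2 do not change along such a direction, so [f] is constant on
    the line. *)
Lemma pd_y_eq0 j f X : (j < 2)%N -> cldiff f -> depends_only_on_y f -> pd j f X = 0.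
Proof.
move=> j2 df yf; apply: cl_ext => A; rewrite pdE cl0E /rpd.
have dg : derivable (comp f A) (0 *: delta_mx 0 j + X) (delta_mx 0 j).
  exact: diff_derivable.
have := derive_val (is_derive := is_derive_line dg); rewrite scale0r add0r => <-.
rewrite (_ : (fun s => _) = cst (comp f A X)); first exact: derive_cst.
apply/funext=> s; rewrite /comp /= (yf _ X) // => k k2.
rewrite !mxE /= (_ : k == j = false) ?mulr0 ?add0r //.
by apply/negP=> /eqP kj; rewrite kj leqNgt j2 in k2.
Qed.

Section CoordinateFunctions.
Variables (phi dphi : R -> R).
Hypothesis dphiE : forall x : R, is_derive x 1 phi (dphi x).

Lemma differentiable_coord_fun (i : 'I_m.+1) X :
  differentiable (fun Y : pt R m => phi (Y ord0 i)) X.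
Proof.
apply: (@differentiable_comp _ _ _ _ (fun Y : pt R m => Y ord0 i) phi).
  exact: differentiable_coord.
by apply/derivable1_diffP; exact: ex_derive.
Qed.

Lemma rpd_coord_fun (i j : 'I_m.+1) X :
  rpd j (fun Y : pt R m => phi (Y ord0 i)) X = (j == i)%:R * dphi (X ord0 i).
Proof.
have lineE h : (h *: delta_mx 0 j + X) ord0 i = h * (j == i)%:R + X ord0 i.
  by rewrite !mxE eqxx /= eq_sym.
rewrite /rpd; have [ji|/negPf nji] := eqVneq j i.
  rewrite mul1r -(derive_val (is_derive := dphiE (X ord0 i))) /derive.
  congr (lim (_ @ 0^'))%classic; apply/funext=> h /=.
  by rewrite lineE ji eqxx.
rewrite mul0r -(derive_cst (0 : R) X (delta_mx 0 j)) /derive.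
congr (lim (_ @ 0^'))%classic; apply/funext=> h /=.
by rewrite lineE nji mulr0 add0r !subrr.
Qed.

End CoordinateFunctions.

End Calculus.

(** * The left and right Dirac operators in y and the map [sandwich] *)

Section DiracOperators.
Set Implicit Arguments.
Unset Strict Implicit.
Variables (R : realType) (m : nat).
Implicit Types (f g : pt R m -> cl R m) (X Y : pt R m) (a b : cl R m).
Local Notation "a ** b" := (clmul a b) (at level 40, left associativity).
Local Notation e1 := (gen R m 1).

(** For [m > 0] this is an involution, as [e1] squares to -1; [a + sandwich a] and [a - sandwich a]
    are twice the projections onto its eigenspaces for 1 and -1. *)
Definition sandwich a := e1 ** a ** e1.

Lemma sandwich_linear : linear sandwich.
Proof. by move=> r a b; rewrite /sandwich clmulDr clmulZr clmulDl clmulZl. Qed.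

HB.instance Definition _ :=
  GRing.isLinear.Build R (cl R m) (cl R m) _ sandwich sandwich_linear.

Lemma dy_leftD f g X : cldiff f -> cldiff g ->
  dy_left (fun X => f X + g X) X = dy_left f X + dy_left g X.
Proof.
move=> df dg; rewrite /dy_left -big_split; apply: eq_bigr => j _ /=.
by rewrite pdD // clmulDr.
Qed.

Lemma dy_rightD f g X : cldiff f -> cldiff g ->
  dy_right (fun X => f X + g X) X = dy_right f X + dy_right g X.
Proof.
move=> df dg; rewrite /dy_right -big_split; apply: eq_bigr => j _ /=.
by rewrite pdD // clmulDl.
Qed.

Section Twist.
Variables L K : {linear cl R m -> cl R m}.

(** Two maps are needed because a generator may alter [L] in passing: a scalar is unchanged, whereas
    [sandwich] changes sign. *)
Lemma dy_left_linear f X :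
  (forall j a, (2 <= j <= m)%N -> gen R m j ** L a = K (gen R m j ** a)) ->
  cldiff f -> dy_left (fun X => L (f X)) X = K (dy_left f X).
Proof.
move=> LK df; rewrite /dy_left linear_sum; apply: eq_bigr => j j2.
by rewrite pd_linear // LK // j2 -ltnS ltn_ord.
Qed.

Lemma dy_right_linear f X :
  (forall j a, (2 <= j <= m)%N -> L a ** gen R m j = K (a ** gen R m j)) ->
  cldiff f -> dy_right (fun X => L (f X)) X = K (dy_right f X).
Proof.
move=> LK df; rewrite /dy_right linear_sum; apply: eq_bigr => j j2.
by rewrite pd_linear // LK // j2 -ltnS ltn_ord.
Qed.

End Twist.

Lemma dy_leftZ (r : R) f X : cldiff f ->
  dy_left (fun X => r *: f X) X = r *: dy_left f X.
Proof.
move=> df; apply: (@dy_left_linear ( *:%R r) ( *:%R r)) => // j a _.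
exact: clmulZr.
Qed.

Lemma dy_rightZ (r : R) f X : cldiff f ->
  dy_right (fun X => r *: f X) X = r *: dy_right f X.
Proof.
move=> df; apply: (@dy_right_linear ( *:%R r) ( *:%R r)) => // j a _.
exact: clmulZl.
Qed.

Lemma gen1_anticomm j : (2 <= j <= m)%N ->
  gen R m j ** e1 = - (e1 ** gen R m j).
Proof.
move=> /andP[j2 jm]; apply: gen_anticomm.
- by rewrite (ltnW j2).
- by rewrite (leq_trans _ jm) // ltnW.
- by rewrite neq_ltn j2 orbT.
Qed.

(** Only the [e1] on the side of the generator has to be crossed, which costs one sign. *)
Lemma gen_sandwich j a : (2 <= j <= m)%N ->
  gen R m j ** sandwich a = - sandwich (gen R m j ** a).
Proof.
by move=> /gen1_anticomm je; rewrite /sandwich !clmulA je !clmulNl.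
Qed.

Lemma sandwich_gen j a : (2 <= j <= m)%N ->
  sandwich a ** gen R m j = - sandwich (a ** gen R m j).
Proof.
by move=> /gen1_anticomm je; rewrite /sandwich -!clmulA je !clmulNr opprK.
Qed.

Lemma dy_left_sandwich f X : cldiff f ->
  dy_left (fun X => sandwich (f X)) X = - sandwich (dy_left f X).
Proof.
apply: (@dy_left_linear sandwich [the {linear cl R m -> cl R m} of -%R \o sandwich]).
exact: gen_sandwich.
Qed.

(** Because of that sign, the Dirac operator exchanges the two eigenspaces of [sandwich]. *)
Lemma dy_left_subr_sandwich f X : cldiff f ->
  dy_left (fun X => f X - sandwich (f X)) X = dy_left f X + sandwich (dy_left f X).
Proof.
apply: (@dy_left_linear [the {linear cl R m -> cl R m} of idfun \- sandwich]
  [the {linear cl R m -> cl R m} of idfun \+ sandwich]) => j a jm /=.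
by rewrite clmulDr clmulNr gen_sandwich // opprK.
Qed.

Lemma dy_right_subr_sandwich f X : cldiff f ->
  dy_right (fun X => f X - sandwich (f X)) X = dy_right f X + sandwich (dy_right f X).
Proof.
apply: (@dy_right_linear [the {linear cl R m -> cl R m} of idfun \- sandwich]
  [the {linear cl R m -> cl R m} of idfun \+ sandwich]) => j a jm /=.
by rewrite clmulDl clmulNl sandwich_gen // opprK.
Qed.

Lemma smooth_subr_sandwich f : smooth f -> smooth (fun X => f X - sandwich (f X)).
Proof.
exact: (@smooth_linear _ _ [the {linear cl R m -> cl R m} of idfun \- sandwich]).
Qed.

Lemma sandwichK a : (0 < m)%N -> sandwich (sandwich a) = a.
Proof.
move=> m0; rewrite /sandwich -!clmulA gen_sqr // !clmulA gen_sqr //.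
by rewrite clmulNr clmulNl clmulNl clmul1l clmul1r opprK.
Qed.

(** In the eigenspace for -1 the zero-order terms [B1 + e1 B1 e1] and [A1 + e1 A1 e1] of the system
    vanish. *)
Lemma sandwich_subr_sandwich a : (0 < m)%N ->
  sandwich (a - sandwich a) = - (a - sandwich a).
Proof. by move=> m0; rewrite linearB /= sandwichK // opprB. Qed.

Lemma smooth_dy_left f : smooth f -> smooth (dy_left f).
Proof.
move=> sf; apply: smooth_sum => j.
by apply: (@smooth_linear _ _ (clmul (gen R m j))); exact: smooth_pd.
Qed.

Lemma dy_left_depends_only_on_y f : depends_only_on_y f -> depends_only_on_y (dy_left f).
Proof.
move=> yf X Y XY; apply: eq_bigr => j _.
by rewrite (pd_depends_only_on_y j yf XY).
Qed.

Lemma dy_right_depends_only_on_y f : depends_only_on_y f -> depends_only_on_y (dy_right f).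
Proof.
move=> yf X Y XY; apply: eq_bigr => j _.
by rewrite (pd_depends_only_on_y j yf XY).
Qed.

Lemma pd_dy_left j f X : smooth f ->
  pd j (dy_left f) X = \sum_(k < m.+1 | (2 <= k)%N) gen R m k ** pd j (pd k f) X.
Proof.
move=> sf; rewrite /dy_left pd_sum; last first.
  by move=> k; apply: (@smooth_linear _ _ (clmul (gen R m k))); exact: smooth_pd.
apply: eq_bigr => k _; apply: (@pd_linear _ _ (clmul (gen R m k))).
exact/smooth_diff/smooth_pd.
Qed.

Lemma pd_dy_right j f X : smooth f ->
  pd j (dy_right f) X = \sum_(k < m.+1 | (2 <= k)%N) pd j (pd k f) X ** gen R m k.
Proof.
move=> sf; rewrite /dy_right pd_sum; last first.
  by move=> k; apply: (@smooth_linear _ _ (clmulr (gen R m k))); exact: smooth_pd.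
apply: eq_bigr => k _; apply: (@pd_linear _ _ (clmulr (gen R m k))).
exact/smooth_diff/smooth_pd.
Qed.

(** Partial derivatives commute by [pd_comm], and left and right multiplications commute by
    associativity. *)
Lemma dy_left_right_comm f X : smooth f ->
  dy_left (dy_right f) X = dy_right (dy_left f) X.
Proof.
move=> sf; rewrite [LHS]/dy_left [RHS]/dy_right.
under eq_bigr do rewrite pd_dy_right // clmul_sumr.
under [RHS]eq_bigr do rewrite pd_dy_left // clmul_suml.
rewrite exchange_big; apply: eq_bigr => j _; apply: eq_bigr => k _.
by rewrite clmulA pd_comm.
Qed.

(** Adding the double sum to its transpose cancels the off-diagonal terms and doubles the diagonal
    ones; the factor 2 is then removed coordinatewise. *)
Lemma sum_anticomm (I : finType) (P : pred I) (T : I -> I -> cl R m) :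
  (forall j k, P j -> P k -> j != k -> T j k = - T k j) ->
  \sum_(j | P j) \sum_(k | P k) T j k = \sum_(j | P j) T j j.
Proof.
move=> Tanti; set S := LHS; set D := RHS.
suff SS : S + S = D + D.
  apply: cl_ext => A; have : (S + S) A = (D + D) A by rewrite SS.
  by rewrite !clE; move: (S A) (D A) => s d; lra.
rewrite {2}/S exchange_big /= /S -big_split /= /D -big_split /=.
apply: eq_bigr => j Pj; rewrite -big_split (bigD1 j) //= big1 ?addr0 //.
by move=> k /andP[Pk kj]; rewrite (Tanti j k) // 1?eq_sym // addNr.
Qed.

Let range (j : 'I_m.+1) : (2 <= j)%N -> (0 < j <= m)%N.
Proof. by move=> j2; rewrite (ltnW j2) -ltnS ltn_ord. Qed.

(** Distinct generators anticommute while partial derivatives commute, so [sum_anticomm] leaves the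
    diagonal terms, where a generator squares to -1. *)
Lemma dy_left_sqr f X : smooth f -> dy_left (dy_left f) X = - lap_y f X.
Proof.
move=> sf; rewrite /dy_left -/(dy_left f).
under eq_bigr => j _.
  rewrite pd_dy_left // clmul_sumr; under eq_bigr do rewrite clmulA; over.
rewrite sum_anticomm.
  rewrite /lap_y -sumrN; apply: eq_bigr => j j2.
  by rewrite (gen_sqr R (range j2)) clmulNl clmul1l.
move=> j k j2 k2 jk.
by rewrite (pd_comm j k X sf) (gen_anticomm R (range j2) (range k2) jk) clmulNl.
Qed.

(** Serves to show that right monogenic functions of y are harmonic. *)
Lemma dy_right_sqr f X : smooth f -> dy_right (dy_right f) X = - lap_y f X.
Proof.
move=> sf; rewrite /dy_right -/(dy_right f).
under eq_bigr => j _.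
  rewrite pd_dy_right // clmul_suml; under eq_bigr do rewrite -clmulA; over.
rewrite sum_anticomm.
  rewrite /lap_y -sumrN; apply: eq_bigr => j j2.
  by rewrite (gen_sqr R (range j2)) clmulNr clmul1r.
move=> j k j2 k2 jk; rewrite eq_sym in jk.
by rewrite (pd_comm j k X sf) (gen_anticomm R (range k2) (range j2) jk) clmulNr.
Qed.

End DiracOperators.

(** * The Cauchy-Riemann operators on a product of a multiplier [u + v e1], constant in y, with a
    function of y *)

Section Monogenic.
Set Implicit Arguments.
Unset Strict Implicit.
Variables (R : realType) (m : nat).
Implicit Types (f g A : pt R m -> cl R m) (X Y : pt R m) (a b : cl R m).
Local Notation "a ** b" := (clmul a b) (at level 40, left associativity).
Local Notation e1 := (gen R m 1).
Local Notation o0 := (inord 0 : 'I_m.+1).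
Local Notation o1 := (inord 1 : 'I_m.+1).

Lemma cplx_mul (u v : R) a : cplx m u v ** a = u *: a + v *: (e1 ** a).
Proof. by rewrite /cplx /clscal clmulDl !clmulZl clmul1l. Qed.

Lemma dX_leftE f X : (0 < m)%N ->
  dX_left f X = pd o0 f X + e1 ** pd o1 f X + dy_left f X.
Proof.
move=> m0; rewrite /dX_left /dy_left (bigD1 o1) /= ?inordK // addrA.
rewrite (_ : ord0 = o0); last by apply/val_inj; rewrite /= inordK.
congr (_ + _); apply: eq_bigl => j.
by rewrite -val_eqE /= inordK // (ltn_neqAle 1) eq_sym andbC.
Qed.

Lemma dX_rightE f X : (0 < m)%N ->
  dX_right f X = pd o0 f X + pd o1 f X ** e1 + dy_right f X.
Proof.
move=> m0; rewrite /dX_right /dy_right (bigD1 o1) /= ?inordK // addrA.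
rewrite (_ : ord0 = o0); last by apply/val_inj; rewrite /= inordK.
congr (_ + _); apply: eq_bigl => j.
by rewrite -val_eqE /= inordK // (ltn_neqAle 1) eq_sym andbC.
Qed.

Lemma dX_leftD f g X : (0 < m)%N -> cldiff f -> cldiff g ->
  dX_left (fun X => f X + g X) X = dX_left f X + dX_left g X.
Proof.
move=> m0 df dg; rewrite !dX_leftE // !pdD // dy_leftD // clmulDr.
by rewrite -!addrA; congr (_ + _); rewrite addrCA; congr (_ + _);
  rewrite [RHS]addrCA; congr (_ + _); rewrite addrCA.
Qed.

Lemma dX_rightD f g X : (0 < m)%N -> cldiff f -> cldiff g ->
  dX_right (fun X => f X + g X) X = dX_right f X + dX_right g X.
Proof.
move=> m0 df dg; rewrite !dX_rightE // !pdD // dy_rightD // clmulDl.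
by rewrite -!addrA; congr (_ + _); rewrite addrCA; congr (_ + _);
  rewrite [RHS]addrCA; congr (_ + _); rewrite addrCA.
Qed.

Section Multiplier.
Variables (u v : pt R m -> R).
Hypotheses (du : forall X, differentiable u X) (dv : forall X, differentiable v X).
Hypothesis u_y : forall (j : 'I_m.+1) X, (2 <= j)%N -> rpd j u X = 0.
Hypothesis v_y : forall (j : 'I_m.+1) X, (2 <= j)%N -> rpd j v X = 0.
Variable A : pt R m -> cl R m.
Hypotheses (dA : cldiff A) (yA : depends_only_on_y A).
Let W X := cplx m (u X) (v X) ** A X.
Let WE : W = (fun X => u X *: A X + v X *: (e1 ** A X)).
Proof. by apply/funext=> X; rewrite /W cplx_mul. Qed.
Let de1A : cldiff (fun X => e1 ** A X).
Proof. exact: (@cldiff_linear _ _ (clmul e1)). Qed.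

Lemma cldiff_cplx_mul : cldiff W.
Proof. by rewrite WE; apply: cldiffD; exact: cldiff_scale. Qed.

Lemma pd_cplx_mul j X :
  pd j W X = cplx m (rpd j u X) (rpd j v X) ** A X + cplx m (u X) (v X) ** pd j A X.
Proof.
rewrite WE pdD; [|exact: cldiff_scale..].
rewrite !pd_scale // (pd_linear (clmul e1)) // !cplx_mul.
by rewrite addrACA.
Qed.

(** A generator of index at least 2 anticommutes with [e1], so moving it across the multiplier
    conjugates the latter. On the right no crossing occurs. *)
Lemma dy_left_cplx_mul X : dy_left W X = cplx m (u X) (- v X) ** dy_left A X.
Proof.
rewrite /dy_left clmul_sumr; apply: eq_bigr => j j2.
rewrite pd_cplx_mul u_y // v_y // !cplx_mul !scale0r !add0r.
have jm : (2 <= j <= m)%N by rewrite j2 -ltnS ltn_ord.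
rewrite clmulDr !clmulZr clmulA (gen1_anticomm _ jm) clmulNl -clmulA.
by rewrite scalerN scaleNr.
Qed.

Lemma dy_right_cplx_mul X : dy_right W X = cplx m (u X) (v X) ** dy_right A X.
Proof.
rewrite /dy_right clmul_sumr; apply: eq_bigr => j j2.
by rewrite pd_cplx_mul u_y // v_y // !cplx_mul !scale0r !add0r !clmulDl !clmulZl clmulA.
Qed.

Hypothesis m1 : (0 < m)%N.

Let pd0W X : pd o0 W X = cplx m (rpd o0 u X) (rpd o0 v X) ** A X.
Proof.
rewrite pd_cplx_mul (pd_y_eq0 _ (j := o0)) ?inordK //.
by rewrite (linear0 (clmul _)) addr0.
Qed.

Let pd1W X : pd o1 W X = cplx m (rpd o1 u X) (rpd o1 v X) ** A X.
Proof.
rewrite pd_cplx_mul (pd_y_eq0 _ (j := o1)) ?inordK //.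
by rewrite (linear0 (clmul _)) addr0.
Qed.

Let e1e1 a : e1 ** (e1 ** a) = - a.
Proof. by rewrite clmulA gen_sqr // clmulNl clmul1l. Qed.

(** The two hypotheses are the Cauchy-Riemann equations at [X]; they cancel the derivatives in x_0
    and x_1 against each other. *)
Lemma dX_left_holomorphic X : rpd o0 u X = rpd o1 v X -> rpd o0 v X = - rpd o1 u X ->
  dX_left W X = cplx m (u X) (- v X) ** dy_left A X.
Proof.
move=> uv vu; rewrite dX_leftE // dy_left_cplx_mul pd0W pd1W uv vu !cplx_mul.
rewrite clmulDr !clmulZr e1e1; apply: cl_ext => C; rewrite !clE.
by move: (A X C) ((e1 ** A X) C) => p q; ring.
Qed.

(** Under the conjugate equations the x_0 term and [e1] times the x_1 term coincide, whence the
    factor 2. *)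
Lemma dX_left_antiholomorphic X : rpd o0 u X = - rpd o1 v X -> rpd o0 v X = rpd o1 u X ->
  dX_left W X = cplx m (rpd o0 u X) (rpd o0 v X) ** (2 *: A X)
              + cplx m (u X) (- v X) ** dy_left A X.
Proof.
move=> uv vu; rewrite dX_leftE // dy_left_cplx_mul pd0W pd1W uv vu !cplx_mul.
rewrite clmulDr !clmulZr e1e1; apply: cl_ext => C; rewrite !clE.
by move: (A X C) ((e1 ** A X) C) => p q; ring.
Qed.

Let e1_sandwich a : e1 ** sandwich a = - (a ** e1).
Proof. by rewrite /sandwich clmulA e1e1 clmulNl. Qed.

(** For a multiplier g the Cauchy-Riemann equations say that its x_1 derivative is [e1] times its
    x_0 derivative. The operator puts another [e1] to the right of [A], so [sandwich] appears; in
    the antiholomorphic case it appears with a minus sign. *)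
Lemma dX_right_holomorphic X : rpd o0 u X = rpd o1 v X -> rpd o0 v X = - rpd o1 u X ->
  dX_right W X = cplx m (rpd o0 u X) (rpd o0 v X) ** (A X + sandwich (A X))
               + cplx m (u X) (v X) ** dy_right A X.
Proof.
move=> uv vu; rewrite dX_rightE // dy_right_cplx_mul pd0W pd1W uv vu !cplx_mul.
rewrite !clmulDl !clmulDr !clmulZl e1_sandwich /sandwich.
apply: cl_ext => C; rewrite !clE.
move: (A X C) ((e1 ** A X) C) ((A X ** e1) C) ((e1 ** A X ** e1) C) => p q r s.
by ring.
Qed.

Lemma dX_right_antiholomorphic X : rpd o0 u X = - rpd o1 v X -> rpd o0 v X = rpd o1 u X ->
  dX_right W X = cplx m (rpd o0 u X) (rpd o0 v X) ** (A X - sandwich (A X))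
               + cplx m (u X) (v X) ** dy_right A X.
Proof.
move=> uv vu; rewrite dX_rightE // dy_right_cplx_mul pd0W pd1W uv vu !cplx_mul.
rewrite !clmulDl !clmulDr !clmulZl !clmulNr e1_sandwich /sandwich.
apply: cl_ext => C; rewrite !clE.
move: (A X C) ((e1 ** A X) C) ((A X ** e1) C) ((e1 ** A X ** e1) C) => p q r s.
by ring.
Qed.

End Multiplier.

End Monogenic.

(** * The Cauchy-Riemann operators on products with cos z, sin z and their conjugates *)

Section Trigonometric.
Set Implicit Arguments.
Unset Strict Implicit.
Variables (R : realType) (m : nat).
Hypothesis m2 : (2 <= m)%N.
Implicit Types (f g A B : pt R m -> cl R m) (X Y : pt R m) (a b : cl R m).
Local Notation "a ** b" := (clmul a b) (at level 40, left associativity).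
Local Notation e1 := (gen R m 1).
Local Notation o0 := (inord 0 : 'I_m.+1).
Local Notation o1 := (inord 1 : 'I_m.+1).

Let m1 : (0 < m)%N. Proof. exact: ltnW. Qed.

Lemma is_derive_expRN (x : R) : is_derive x 1 (expR \o -%R : R -> R) (- expR (- x)).
Proof.
rewrite -mulrN1; apply: (@is_derive1_comp R expR -%R); exact: is_deriveNid.
Qed.

Lemma is_derive_cosh (x : R) : is_derive x 1 (@cosh R) (sinh x).
Proof.
rewrite (_ : @cosh R = (2^-1 : R) *: (expR + (expR \o -%R))); last first.
  by apply/funext=> y; exact: mulrC.
rewrite (_ : sinh x = 2^-1 *: (expR x + - expR (- x))); last exact: mulrC.
by apply: is_deriveZ; apply: is_deriveD; exact: is_derive_expRN.
Qed.

Lemma is_derive_sinh (x : R) : is_derive x 1 (@sinh R) (cosh x).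
Proof.
rewrite (_ : @sinh R = (2^-1 : R) *: (expR - (expR \o -%R))); last first.
  by apply/funext=> y; exact: mulrC.
rewrite (_ : cosh x = 2^-1 *: (expR x - - expR (- x))); last by rewrite opprK; exact: mulrC.
by apply: is_deriveZ; apply: is_deriveB; exact: is_derive_expRN.
Qed.

Lemma cosh0 : cosh (0 : R) = 1.
Proof. by rewrite /cosh oppr0 expR0 divff. Qed.

Lemma sinh0 : sinh (0 : R) = 0.
Proof. by rewrite /sinh oppr0 subrr mul0r. Qed.

Lemma sinh1_neq0 : sinh (1 : R) != 0.
Proof.
by rewrite /sinh mulf_neq0 ?invr_eq0 ?pnatr_eq0 // subr_eq0 gt_eqF // ltr_expR.
Qed.

Section Separated.
Variables (p dp q dq : R -> R).
Hypothesis dpE : forall x : R, is_derive x 1 p (dp x).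
Hypothesis dqE : forall x : R, is_derive x 1 q (dq x).
Let u X := p (coord X 0) * q (coord X 1).

Let dp0 X : differentiable (fun X : pt R m => p (coord X 0)) X.
Proof. exact: (differentiable_coord_fun dpE). Qed.

Let dq1 X : differentiable (fun X : pt R m => q (coord X 1)) X.
Proof. exact: (differentiable_coord_fun dqE). Qed.

Lemma differentiable_separated X : differentiable u X.
Proof. exact: differentiableM. Qed.

Let rpd_separated j X : rpd j u X =
  (j == o0)%:R * (dp (coord X 0) * q (coord X 1)) +
  (j == o1)%:R * (p (coord X 0) * dq (coord X 1)).
Proof.
rewrite /rpd (_ : u = (fun X => p (coord X 0)) * (fun X => q (coord X 1))) //.
rewrite deriveM; [|exact: diff_derivable..].
have := rpd_coord_fun dpE o0 j X; rewrite /rpd => ->.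
have := rpd_coord_fun dqE o1 j X; rewrite /rpd => ->.
rewrite /GRing.scale /= /coord.
by move: (p _) (q _) (dp _) (dq _) => ? ? ? ?; ring.
Qed.

Lemma rpd0_separated X : rpd o0 u X = dp (coord X 0) * q (coord X 1).
Proof.
by rewrite rpd_separated eqxx -val_eqE /= !inordK // mul1r mul0r addr0.
Qed.

Lemma rpd1_separated X : rpd o1 u X = p (coord X 0) * dq (coord X 1).
Proof.
by rewrite rpd_separated eqxx -val_eqE /= !inordK // mul1r mul0r add0r.
Qed.

Lemma rpd_separated_y (j : 'I_m.+1) X : (2 <= j)%N -> rpd j u X = 0.
Proof.
move=> j2; rewrite rpd_separated -!val_eqE /= !inordK //.
by rewrite !gtn_eqF ?mul0r ?addr0 // ltnW.
Qed.

End Separated.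

Lemma cplxN (u v : R) a : cplx m (- u) (- v) ** a = - (cplx m u v ** a).
Proof. by rewrite !cplx_mul !scaleNr opprD. Qed.

Let dcos (x : R) : is_derive x 1 (@cos R) (- sin x). Proof. exact: is_derive_cos. Qed.
Let dsin (x : R) : is_derive x 1 (@sin R) (cos x). Proof. exact: is_derive_sin. Qed.
Let dNcos (x : R) : is_derive x 1 (fun x : R => - cos x) (sin x).
Proof. by rewrite -[sin x]opprK; apply: is_deriveN. Qed.
Let dNsin (x : R) : is_derive x 1 (fun x : R => - sin x) (- cos x).
Proof. by apply: is_deriveN. Qed.

Section Blocks.
Variables (A : pt R m -> cl R m) (dA : cldiff A) (yA : depends_only_on_y A).

(** The minus sign is moved onto the factor in x_0, so that the imaginary part is again a product
    [p (coord X 0) * q (coord X 1)]. *)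
Let cos_zE : (fun X => cos_z X ** A X) = (fun X => cplx m
  (cos (coord X 0) * cosh (coord X 1)) (- sin (coord X 0) * sinh (coord X 1)) ** A X).
Proof. by apply/funext=> X; rewrite mulNr. Qed.

Let sin_zbarE : (fun X => sin_zbar X ** A X) = (fun X => cplx m
  (sin (coord X 0) * cosh (coord X 1)) (- cos (coord X 0) * sinh (coord X 1)) ** A X).
Proof. by apply/funext=> X; rewrite mulNr. Qed.

Let dcoscosh := differentiable_separated dcos is_derive_cosh.
Let dsincosh := differentiable_separated dsin is_derive_cosh.
Let dcossinh := differentiable_separated dcos is_derive_sinh.
Let dsinsinh := differentiable_separated dsin is_derive_sinh.
Let dNcossinh := differentiable_separated dNcos is_derive_sinh.
Let dNsinsinh := differentiable_separated dNsin is_derive_sinh.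
Let ycoscosh := rpd_separated_y dcos is_derive_cosh.
Let ysincosh := rpd_separated_y dsin is_derive_cosh.
Let ycossinh := rpd_separated_y dcos is_derive_sinh.
Let ysinsinh := rpd_separated_y dsin is_derive_sinh.
Let yNcossinh := rpd_separated_y dNcos is_derive_sinh.
Let yNsinsinh := rpd_separated_y dNsin is_derive_sinh.
Let r0 := (rpd0_separated dcos is_derive_cosh, rpd0_separated dsin is_derive_cosh,
  rpd0_separated dcos is_derive_sinh, rpd0_separated dsin is_derive_sinh,
  rpd0_separated dNcos is_derive_sinh, rpd0_separated dNsin is_derive_sinh).
Let r1 := (rpd1_separated dcos is_derive_cosh, rpd1_separated dsin is_derive_cosh,
  rpd1_separated dcos is_derive_sinh, rpd1_separated dsin is_derive_sinh,
  rpd1_separated dNcos is_derive_sinh, rpd1_separated dNsin is_derive_sinh).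

Lemma cldiff_cos_z : cldiff (fun X => cos_z X ** A X).
Proof. by rewrite cos_zE; exact: cldiff_cplx_mul. Qed.

Lemma cldiff_sin_z : cldiff (fun X => sin_z X ** A X).
Proof. exact: cldiff_cplx_mul. Qed.

Lemma cldiff_cos_zbar : cldiff (fun X => cos_zbar X ** A X).
Proof. exact: cldiff_cplx_mul. Qed.

Lemma cldiff_sin_zbar : cldiff (fun X => sin_zbar X ** A X).
Proof. by rewrite sin_zbarE; exact: cldiff_cplx_mul. Qed.

(** The multiplier is holomorphic, so only the y part acts, and it conjugates cos z on its way. *)
Lemma dX_left_cos_z X :
  dX_left (fun X => cos_z X ** A X) X = cos_zbar X ** dy_left A X.
Proof.
rewrite cos_zE dX_left_holomorphic //.
- by rewrite mulNr opprK.
- by rewrite r0 r1.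
- by rewrite r0 r1 mulNr.
Qed.

Lemma dX_left_sin_z X :
  dX_left (fun X => sin_z X ** A X) X = sin_zbar X ** dy_left A X.
Proof.
rewrite dX_left_holomorphic //.
- by rewrite r0 r1.
- by rewrite r0 r1 mulNr.
Qed.

(** The multiplier is antiholomorphic with x_0 derivative [- sin_zbar], which enters twice. *)
Lemma dX_left_cos_zbar X : dX_left (fun X => cos_zbar X ** A X) X =
  - (sin_zbar X ** (2 *: A X)) + cos_z X ** dy_left A X.
Proof.
rewrite dX_left_antiholomorphic //.
- by rewrite !r0 -cplxN opprK mulNr.
- by rewrite r0 r1 mulNr.
- by rewrite r0 r1.
Qed.

Lemma dX_left_sin_zbar X : dX_left (fun X => sin_zbar X ** A X) X =
  cos_zbar X ** (2 *: A X) + sin_z X ** dy_left A X.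
Proof.
rewrite sin_zbarE dX_left_antiholomorphic //.
- by rewrite !r0 mulNr opprK.
- by rewrite r0 r1 mulNr opprK.
- by rewrite r0 r1.
Qed.

Lemma dX_right_cos_z X : dX_right (fun X => cos_z X ** A X) X =
  - (sin_z X ** (A X + sandwich (A X))) + cos_z X ** dy_right A X.
Proof.
rewrite cos_zE dX_right_holomorphic //.
- by rewrite !r0 -cplxN !mulNr.
- by rewrite r0 r1.
- by rewrite r0 r1 mulNr.
Qed.

Lemma dX_right_sin_z X : dX_right (fun X => sin_z X ** A X) X =
  cos_z X ** (A X + sandwich (A X)) + sin_z X ** dy_right A X.
Proof.
rewrite dX_right_holomorphic //.
- by rewrite !r0 mulNr.
- by rewrite r0 r1.
- by rewrite r0 r1 mulNr.
Qed.

Lemma dX_right_cos_zbar X : dX_right (fun X => cos_zbar X ** A X) X =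
  - (sin_zbar X ** (A X - sandwich (A X))) + cos_zbar X ** dy_right A X.
Proof.
rewrite dX_right_antiholomorphic //.
- by rewrite !r0 -cplxN opprK mulNr.
- by rewrite r0 r1 mulNr.
- by rewrite r0 r1.
Qed.

Lemma dX_right_sin_zbar X : dX_right (fun X => sin_zbar X ** A X) X =
  cos_zbar X ** (A X - sandwich (A X)) + sin_zbar X ** dy_right A X.
Proof.
rewrite sin_zbarE dX_right_antiholomorphic //.
- by rewrite !r0 mulNr.
- by rewrite r0 r1 mulNr opprK.
- by rewrite r0 r1.
Qed.

End Blocks.

End Trigonometric.

(** Reads an identity in one coordinate and turns all coordinate values into real variables.
    Clifford products stay opaque, so what remains is linear in them and within reach of [ring]. *)
Ltac cl_coordinates :=
  apply: cl_ext => ?; rewrite !clE;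
  repeat match goal with
  | |- context [fun_of_fin ?f ?C] => let x := fresh "x" in move: (fun_of_fin f C) => x
  end.

(** * Linear independence of the four multipliers and the criterion for two-sided monogenicity *)

Section TwoSidedMonogenic.
Set Implicit Arguments.
Unset Strict Implicit.
Variables (R : realType) (m : nat).
Hypothesis m2 : (2 <= m)%N.
Implicit Types (f g A B : pt R m -> cl R m) (X Y : pt R m) (a b c d : cl R m).
Local Notation "a ** b" := (clmul a b) (at level 40, left associativity).
Local Notation e1 := (gen R m 1).

Let m1 : (0 < m)%N. Proof. exact: ltnW. Qed.

Definition trig_comb (A1 B1 A2 B2 : pt R m -> cl R m) : pt R m -> cl R m := fun X =>
  cos_z X ** A1 X + sin_z X ** B1 X + cos_zbar X ** A2 X + sin_zbar X ** B2 X.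

Lemma gen1_mulI : injective (clmul e1).
Proof.
move=> a b /(congr1 (clmul e1)); rewrite !clmulA !gen_sqr // !clmulNl !clmul1l.
exact: oppr_inj.
Qed.

(* The values at (x_0, x_1) = (0, 0), (0, 1), (pi/2, 0), (pi/2, 1) separate the four
   products cos x_0 cosh x_1, cos x_0 sinh x_1, sin x_0 cosh x_1, sin x_0 sinh x_1. *)
Lemma trig_comb_eq0 A1 B1 A2 B2 :
  depends_only_on_y A1 -> depends_only_on_y B1 ->
  depends_only_on_y A2 -> depends_only_on_y B2 ->
  (forall X, trig_comb A1 B1 A2 B2 X = 0) ->
  forall X, [/\ A1 X = 0, B1 X = 0, A2 X = 0 & B2 X = 0].
Proof.
(* Below, [P s t] replaces the first two coordinates of [X] and keeps y, so the coefficients have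
   the same values at [P s t] as at [X]. *)
move=> yA1 yB1 yA2 yB2 F0 X.
pose P (s t : R) : pt R m := \row_k
  (if k == inord 0 then s else if k == inord 1 then t else X ord0 k).
have PX s t (k : 'I_m.+1) : (2 <= k)%N -> P s t ord0 k = X ord0 k.
  by move=> k2; rewrite mxE -!val_eqE /= !inordK // !gtn_eqF // ltnW.
have P0 s t : coord (P s t) 0 = s by rewrite /coord mxE eqxx.
have P1 s t : coord (P s t) 1 = t.
  by rewrite /coord mxE eqxx -val_eqE /= !inordK.
have E s t : (cos s * cosh t) *: (A1 X + A2 X)
    + (sin s * sinh t) *: (e1 ** A2 X - e1 ** A1 X)
    + (sin s * cosh t) *: (B1 X + B2 X)
    + (cos s * sinh t) *: (e1 ** B1 X - e1 ** B2 X) = 0.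
  rewrite -(F0 (P s t)) /trig_comb /cos_z /sin_z /cos_zbar /sin_zbar !P0 !P1.
  rewrite (yA1 _ X) ?(yB1 _ X) ?(yA2 _ X) ?(yB2 _ X); try exact: PX.
  rewrite !cplx_mul; move: (cos s) (sin s) (cosh t) (sinh t) => p q r h.
  move: (e1 ** A1 X) (e1 ** A2 X) (e1 ** B1 X) (e1 ** B2 X) => ? ? ? ?.
  by cl_coordinates; ring.
have A12 : A1 X + A2 X = 0.
  by rewrite -(E 0 0) cos0 sin0 cosh0 sinh0 !mul0r !mulr0 !mulr1 !scale0r !addr0 scale1r.
have B12 : B1 X + B2 X = 0.
  by rewrite -(E (pi / 2) 0) cos_pihalf sin_pihalf cosh0 sinh0 !mul0r !mulr0 !mulr1
             !scale0r !addr0 !add0r scale1r.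
(* The sums [A1 X + A2 X] and [B1 X + B2 X] are already zero, so at (0, 1) only [sinh 1] times
   [e1 B1 - e1 B2] is left. *)
have eqB : B1 X = B2 X.
  apply: gen1_mulI; apply/eqP; rewrite -subr_eq0; have := E 0 1.
  rewrite A12 B12 !scaler0 cos0 sin0 !mul0r scale0r !add0r mul1r => /eqP.
  by rewrite scaler_eq0 (negPf (sinh1_neq0 R)).
have eqA : A2 X = A1 X.
  apply: gen1_mulI; apply/eqP; rewrite -subr_eq0; have := E (pi / 2) 1.
  rewrite A12 B12 !scaler0 cos_pihalf sin_pihalf !mul0r scale0r addr0 add0r mul1r addr0 => /eqP.
  by rewrite scaler_eq0 (negPf (sinh1_neq0 R)).
have half (a : cl R m) : a + a = 0 -> a = 0.
  move=> aa; apply: cl_ext => C; have : (a + a) C = 0 by rewrite aa cl0E.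
  by rewrite !clE; move: (a C) => r; lra.
rewrite eqA in A12; rewrite eqB in B12.
by rewrite eqA eqB (half _ A12) (half _ B12).
Qed.

Section Monogenicity.
Variables A1 B1 A2 B2 : pt R m -> cl R m.
Hypotheses (sA1 : smooth A1) (sB1 : smooth B1) (sA2 : smooth A2) (sB2 : smooth B2).
Hypotheses (yA1 : depends_only_on_y A1) (yB1 : depends_only_on_y B1).
Hypotheses (yA2 : depends_only_on_y A2) (yB2 : depends_only_on_y B2).

Let dA1 := smooth_diff sA1.
Let dB1 := smooth_diff sB1.
Let dA2 := smooth_diff sA2.
Let dB2 := smooth_diff sB2.

Lemma dX_left_trig_comb X : dX_left (trig_comb A1 B1 A2 B2) X =
  trig_comb (dy_left A2) (dy_left B2)
    (fun X => dy_left A1 X + 2 *: B2 X) (fun X => dy_left B1 X - 2 *: A2 X) X.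
Proof.
have d1 := cldiff_cos_z dA1; have d2 := cldiff_sin_z dB1.
have d3 := cldiff_cos_zbar dA2; have d4 := cldiff_sin_zbar dB2.
have d12 := cldiffD d1 d2; have d123 := cldiffD d12 d3.
rewrite /trig_comb dX_leftD // dX_leftD // dX_leftD //.
rewrite dX_left_cos_z // dX_left_sin_z // dX_left_cos_zbar // dX_left_sin_zbar //.
rewrite !clmulDr clmulNr.
by cl_coordinates; ring.
Qed.

Lemma dX_right_trig_comb X : dX_right (trig_comb A1 B1 A2 B2) X =
  trig_comb (fun X => dy_right A1 X + (B1 X + sandwich (B1 X)))
    (fun X => dy_right B1 X - (A1 X + sandwich (A1 X)))
    (fun X => dy_right A2 X + (B2 X - sandwich (B2 X)))
    (fun X => dy_right B2 X - (A2 X - sandwich (A2 X))) X.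
Proof.
have d1 := cldiff_cos_z dA1; have d2 := cldiff_sin_z dB1.
have d3 := cldiff_cos_zbar dA2; have d4 := cldiff_sin_zbar dB2.
have d12 := cldiffD d1 d2; have d123 := cldiffD d12 d3.
rewrite /trig_comb dX_rightD // dX_rightD // dX_rightD //.
rewrite dX_right_cos_z // dX_right_sin_z // dX_right_cos_zbar // dX_right_sin_zbar //.
rewrite !(clmulDr, clmulNr).
by cl_coordinates; ring.
Qed.

Lemma two_sided_monogenicP : two_sided_monogenic (trig_comb A1 B1 A2 B2) <->
  [/\ harmonic A1 /\ harmonic B1,
      forall X, dy_right A1 X + B1 X + sandwich (B1 X) = 0,
      forall X, dy_right B1 X - A1 X - sandwich (A1 X) = 0,
      forall X, A2 X = 2^-1 *: dy_left B1 X &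
      forall X, B2 X = - (2^-1 *: dy_left A1 X)].
Proof.
have dsA : cldiff (fun X => sandwich (A1 X)) by exact: cldiff_linear dA1.
have dsB : cldiff (fun X => sandwich (B1 X)) by exact: cldiff_linear dB1.
have dyA : cldiff (dy_left A1) by exact/smooth_diff/smooth_dy_left.
have dyB : cldiff (dy_left B1) by exact/smooth_diff/smooth_dy_left.
have ysum f g : depends_only_on_y f -> depends_only_on_y g ->
    depends_only_on_y (fun X => f X + g X).
  by move=> yf yg X Y XY; rewrite (yf X Y XY) (yg X Y XY).
have ymap (L : cl R m -> cl R m) f : depends_only_on_y f ->
    depends_only_on_y (fun X => L (f X)).
  by move=> yf X Y XY; rewrite (yf X Y XY).
have yl := dy_left_depends_only_on_y.
have yr := dy_right_depends_only_on_y.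
split=> [[Fl Fr]|[[hA hB] rA rB A2E B2E]].
  (* The coefficients produced by either operator again depend only on y, so the independence lemma
     applies to them. *)
  have L0 X := trig_comb_eq0 (yl _ _ _ yA2) (yl _ _ _ yB2)
    (ysum _ _ (yl _ _ _ yA1) (ymap (fun a => 2 *: a) _ yB2))
    (ysum _ _ (yl _ _ _ yB1) (ymap (fun a => - (2 *: a)) _ yA2))
    (fun X => etrans (esym (dX_left_trig_comb X)) (Fl X)) X.
  have R0 X := trig_comb_eq0
    (ysum _ _ (yr _ _ _ yA1) (ymap (fun a => a + sandwich a) _ yB1))
    (ysum _ _ (yr _ _ _ yB1) (ymap (fun a => - (a + sandwich a)) _ yA1))
    (ysum _ _ (yr _ _ _ yA2) (ymap (fun a => a - sandwich a) _ yB2))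
    (ysum _ _ (yr _ _ _ yB2) (ymap (fun a => - (a - sandwich a)) _ yA2))
    (fun X => etrans (esym (dX_right_trig_comb X)) (Fr X)) X.
  have half a b : a + 2 *: b = 0 -> b = - (2^-1 *: a).
    move=> ab; apply: cl_ext => C; have : (a + 2 *: b) C = 0 by rewrite ab cl0E.
    by rewrite !clE; move: (a C) (b C) => p q; lra.
  have A2E X : A2 X = 2^-1 *: dy_left B1 X.
    have [_ _ _ E] := L0 X.
    by rewrite -[A2 X]opprK (half (dy_left B1 X) (- A2 X)) ?opprK // scalerN.
  have B2E X : B2 X = - (2^-1 *: dy_left A1 X).
    by have [_ _ E _] := L0 X; exact: half.
  have n2 : (2^-1 : R) != 0 by rewrite invr_eq0 pnatr_eq0.
  split=> [|X|X||] //.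
  (* Harmonicity of [A1] comes from the vanishing of [dy_left B2], that of [B1] from the vanishing
     of [dy_left A2], once [B2] and [A2] are replaced by their expressions. *)
  - split=> X; apply/eqP; rewrite -oppr_eq0 -dy_left_sqr //.
      have [_ + _ _] := L0 X; rewrite (_ : B2 = (fun X => - 2^-1 *: dy_left A1 X)).
        by rewrite dy_leftZ // => /eqP; rewrite scaler_eq0 oppr_eq0 (negPf n2).
      by apply/funext=> Y; rewrite scaleNr.
    have [+ _ _ _] := L0 X; rewrite (_ : A2 = (fun X => 2^-1 *: dy_left B1 X)).
      by rewrite dy_leftZ // => /eqP; rewrite scaler_eq0 (negPf n2).
    exact/funext.
  - by have [E _ _ _] := R0 X; rewrite -addrA.
  - by have [_ E _ _] := R0 X; rewrite -addrA -opprD.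
have A2F : A2 = (fun X => 2^-1 *: dy_left B1 X) by exact/funext.
have B2F : B2 = (fun X => - 2^-1 *: dy_left A1 X).
  by apply/funext=> X; rewrite scaleNr.
(* As equalities of functions, the two right equations can be substituted under [dy_left]. *)
have rAE : dy_right A1 = (fun X => - (1 : R) *: (B1 X + sandwich (B1 X))).
  apply/funext=> X; apply/eqP; rewrite scaleN1r -addr_eq0 addrA; apply/eqP; exact: rA.
have rBE : dy_right B1 = (fun X => A1 X + sandwich (A1 X)).
  apply/funext=> X; apply/eqP; rewrite -subr_eq0 opprD addrA; apply/eqP; exact: rB.
(* Writing 0 as a combination with zero coefficients lets the coefficients be compared one by
   one. *)
have c0 X : trig_comb (fun=> 0) (fun=> 0) (fun=> 0) (fun=> 0) X = 0 :> cl R m.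
  by rewrite /trig_comb !(linear0 (clmul _)) !addr0.
split=> X.
  rewrite dX_left_trig_comb -(c0 X) /trig_comb A2F B2F !dy_leftZ // !dy_left_sqr //.
  rewrite hA hB oppr0 !scaler0 !scalerA mulrN divff ?pnatr_eq0 //.
  by rewrite scaleN1r scale1r !subrr.
rewrite dX_right_trig_comb -(c0 X) /trig_comb.
(* Commuting the operators leads back to [dy_right A1], known from [rAE], and [dy_left] changes the
   sign of the [sandwich] term. Up to the factor 1/2, [lrA] and [lrB] are the two remaining right
   conditions. *)
have lrA : dy_right (dy_left A1) X = - (dy_left B1 X - sandwich (dy_left B1 X)).
  rewrite -dy_left_right_comm // rAE dy_leftZ; last exact: cldiffD.
  by rewrite dy_leftD // dy_left_sandwich // scaleN1r.
have lrB : dy_right (dy_left B1) X = dy_left A1 X - sandwich (dy_left A1 X).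
  by rewrite -dy_left_right_comm // rBE dy_leftD // dy_left_sandwich.
congr (_ ** _ + _ ** _ + _ ** _ + _ ** _).
- by rewrite addrA rA.
- by rewrite opprD addrA rB.
- rewrite A2F B2F dy_rightZ // lrB linearZ /=.
  by cl_coordinates; ring.
- rewrite A2F B2F dy_rightZ // lrA linearZ /=.
  by cl_coordinates; ring.
Qed.

End Monogenicity.

End TwoSidedMonogenic.

(** * The equivalence, and the family built from right monogenic functions *)

Theorem theorem2 (R : realType) (m : nat) (hm : (2 <= m)%N) :
  (forall A1 B1 A2 B2 : pt R m -> cl R m,
     smooth A1 -> smooth B1 -> smooth A2 -> smooth B2 ->
     depends_only_on_y A1 -> depends_only_on_y B1 ->
     depends_only_on_y A2 -> depends_only_on_y B2 ->
     (two_sided_monogenic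
        (fun X => clmul (cos_z X) (A1 X) + clmul (sin_z X) (B1 X)
                + clmul (cos_zbar X) (A2 X) + clmul (sin_zbar X) (B2 X))
      <->
      harmonic A1 /\ harmonic B1 /\
          (forall X, dy_right A1 X + B1 X + clmul (clmul (gen R m 1) (B1 X)) (gen R m 1) = 0) /\
          (forall X, dy_right B1 X - A1 X - clmul (clmul (gen R m 1) (A1 X)) (gen R m 1) = 0) /\
          (forall X, A2 X = (1 / 2 : R) *: dy_left B1 X) /\
          (forall X, B2 X = - ((1 / 2 : R) *: dy_left A1 X))))
  /\
  (forall M N : pt R m -> cl R m,
     smooth M -> smooth N ->
     depends_only_on_y M -> depends_only_on_y N ->
     (forall X, dy_right M X = 0) -> (forall X, dy_right N X = 0) ->
     two_sided_monogenic
       (fun X =>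
          clmul (cos_z X) (M X - clmul (clmul (gen R m 1) (M X)) (gen R m 1))
        + clmul (sin_z X) (N X - clmul (clmul (gen R m 1) (N X)) (gen R m 1))
        + (1 / 2 : R) *: clmul (cos_zbar X)
              (dy_left N X + clmul (clmul (gen R m 1) (dy_left N X)) (gen R m 1))
        - (1 / 2 : R) *: clmul (sin_zbar X)
              (dy_left M X + clmul (clmul (gen R m 1) (dy_left M X)) (gen R m 1)))).
Proof.
split.
  move=> A1 B1 A2 B2 sA1 sB1 sA2 sB2 yA1 yB1 yA2 yB2.
  rewrite div1r.
  apply: (iff_trans (two_sided_monogenicP hm sA1 sB1 sA2 sB2 yA1 yB1 yA2 yB2)).
  by split=> [[[? ?] ? ? ? ?]|[? [? [? [? [? ?]]]]]]; do !split.
(* The family is the case [A1 = M - e1 M e1], [B1 = N - e1 N e1] of the criterion. *)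
move=> M N sM sN yM yN rM rN.
have sMM := smooth_subr_sandwich sM; have sNN := smooth_subr_sandwich sN.
have yT (f : pt R m -> cl R m) : depends_only_on_y f ->
    depends_only_on_y (fun X => f X - sandwich (f X)).
  by move=> yf X Y XY; rewrite (yf X Y XY).
have sZ (r : R) (f : pt R m -> cl R m) : smooth f -> smooth (fun X => r *: f X).
  exact: (@smooth_linear _ _ ( *:%R r)).
have harm (f : pt R m -> cl R m) : smooth f -> (forall X, dy_right f X = 0) -> harmonic f.
  move=> sf rf X; apply/eqP; rewrite -oppr_eq0 -dy_right_sqr //; apply/eqP.
  (* The zero function is written as [0 *: f], so that [dy_rightZ] evaluates the second application
     of the operator. *)
  rewrite (_ : dy_right f = (fun X => 0 *: f X)).
    by rewrite dy_rightZ ?scale0r //; exact: smooth_diff.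
  by apply/funext=> Y; rewrite scale0r.
have rT (f : pt R m -> cl R m) : smooth f -> (forall X, dy_right f X = 0) ->
    forall X, dy_right (fun X => f X - sandwich (f X)) X = 0.
  move=> sf rf X; rewrite dy_right_subr_sandwich; last exact: smooth_diff.
  by rewrite rf linear0 addr0.
have lT (f : pt R m -> cl R m) : smooth f ->
    dy_left (fun X => f X - sandwich (f X)) =
    (fun X => dy_left f X + sandwich (dy_left f X)).
  by move=> sf; apply/funext=> X; rewrite dy_left_subr_sandwich //; exact: smooth_diff.
have m_gt0 : (0 < m)%N by exact: ltnW.
have sA2 := sZ (1 / 2) _ (smooth_dy_left sNN).
have sB2 := sZ (- (1 / 2)) _ (smooth_dy_left sMM).
have yZ (r : R) (f : pt R m -> cl R m) : depends_only_on_y f ->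
    depends_only_on_y (fun X => r *: f X).
  by move=> yf X Y XY; rewrite (yf X Y XY).
have yA2 := yZ (1 / 2) _ (dy_left_depends_only_on_y (yT _ yN)).
have yB2 := yZ (- (1 / 2)) _ (dy_left_depends_only_on_y (yT _ yM)).
(* By [lT], the terms [dy N + e1 (dy N) e1] and [dy M + e1 (dy M) e1] are the left derivatives of
   [B1] and [A1], as the criterion prescribes for [A2] and [B2]. *)
rewrite [X in two_sided_monogenic X](_ : _ = trig_comb
    (fun X => M X - sandwich (M X)) (fun X => N X - sandwich (N X))
    (fun X => (1 / 2) *: dy_left (fun X => N X - sandwich (N X)) X)
    (fun X => - (1 / 2) *: dy_left (fun X => M X - sandwich (M X)) X)).
  apply/(two_sided_monogenicP hm sMM sNN sA2 sB2 (yT _ yM) (yT _ yN) yA2 yB2).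
  split=> [|X|X|X|X].
  - by split; apply: harm => //; exact: rT.
  - by rewrite rT // add0r sandwich_subr_sandwich // subrr.
  - by rewrite rT // add0r sandwich_subr_sandwich // subrr.
  - by rewrite div1r.
  - by rewrite div1r scaleNr.
by apply/funext=> X; rewrite /trig_comb !lT // scaleNr clmulNr !clmulZr.
Qed.
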